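(* Let $G$ be a graph on $n$ nodes, which is neither complete nor null, and let $\delta=1/\lambda_1(\bar{A})$, where $\lambda_1(\bar{A})$ is the largest eigenvalue of $\bar{A}$, the adjacency matrix of the complement graph $\bar{G}$. Then $G$ admits a unique, up to an isometry, $J$-spherical representation, whose Euclidean distance matrix is given by \[ D=2(E-I)+2\delta\bar{A}. \] Moreover, $\dim_J(G)=n-m(\lambda_1(\bar{A}))$, where $m(\lambda_1(\bar{A}))$ is the multiplicity of the eigenvalue $\lambda_1(\bar{A})$ of $\bar{A}$.
   Context: Graphs are simple; the null graph is the graph with no edges. $E$ is the $n\times n$ all-ones matrix and $I$ the identity. The Euclidean distance matrix of points $p^1,\ldots,p^n$ is $D=(\|p^i-p^j\|^2)_{i,j}$. A $J$-spherical representation of $G$ in $\mathbb{R}^r$ is a configuration of points $p^1,\ldots,p^n\in\mathbb{R}^r$, lying on an $(r-1)$-sphere in $\mathbb{R}^r$ of radius $1$, for which there is a scalar $\beta>2$ such that for all $i\neq j$, $\|p^i-p^j\|^2=2$ if $\{i,j\}$ is an edge of $G$, and $\|p^i-p^j\|^2=\beta$ otherwise. Throughout, the points are assumed to lie in $\mathbb{R}^r$ with $r$ equal to the dimension of their affine span (so they affinely span $\mathbb{R}^r$). $\dim_J(G)$ is the smallest $r$ for which $G$ admits a $J$-spherical representation in $\mathbb{R}^r$. *)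

(* Defs.v *)
From HB Require Import structures.
From mathcomp Require Import all_boot all_order all_algebra.
From mathcomp Require Import classical_sets reals.

Set Implicit Arguments.
Unset Strict Implicit.
Unset Printing Implicit Defensive.

Import Order.TTheory GRing.Theory Num.Theory.
Local Open Scope classical_set_scope.
Local Open Scope ring_scope.

Record sgraph (n : nat) := SGraph {
  adj :> rel 'I_n;
  adj_sym : symmetric adj;
  adj_irrefl : irreflexive adj }.

Definition complete_graph n (g : sgraph n) : Prop :=
  forall i j : 'I_n, i != j -> g i j.

Definition null_graph n (g : sgraph n) : Prop :=
  forall i j : 'I_n, ~~ g i j.

Definition compl_adj n (g : sgraph n) : rel 'I_n :=
  fun i j => (i != j) && ~~ g i j.

Lemma compl_adj_sym n (g : sgraph n) : symmetric (compl_adj g).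
Proof. by move=> i j; rewrite /compl_adj eq_sym adj_sym. Qed.

Lemma compl_adj_irrefl n (g : sgraph n) : irreflexive (compl_adj g).
Proof. by move=> i; rewrite /compl_adj eqxx. Qed.

Definition compl_graph n (g : sgraph n) : sgraph n :=
  SGraph (compl_adj_sym g) (compl_adj_irrefl g).

Definition adjmx (R : realType) n (g : sgraph n) : 'M[R]_n :=
  \matrix_(i, j) (g i j)%:R.

(* The default 0 is returned only if the set of eigenvalues has no maximum,
   which does not happen for a symmetric matrix of positive size. *)
Definition largest_eigenvalue (R : realType) n (A : 'M[R]_n) : R :=
  let spectrum := [set a | eigenvalue A a] in
  xget 0 (spectrum `&` ubound spectrum).

(* Dimension of the eigenspace; for a symmetric matrix this is also the
   multiplicity of a as a root of the characteristic polynomial. *)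
Definition eigen_mult (R : realType) n (A : 'M[R]_n) (a : R) : nat :=
  \rank (eigenspace A a).

(* Squared Euclidean distance: the library's norm on row vectors is the
   max norm. *)
Definition sqdist (R : realType) r (x y : 'rV[R]_r) : R :=
  \sum_(k < r) (x 0 k - y 0 k) ^+ 2.

Definition edm (R : realType) n r (p : 'I_n -> 'rV[R]_r) : 'M[R]_n :=
  \matrix_(i, j) sqdist (p i) (p j).

Definition affinely_spans (R : realType) n r (p : 'I_n -> 'rV[R]_r) : Prop :=
  forall x : 'rV[R]_r, exists2 w : 'I_n -> R,
    \sum_i w i = 1 & x = \sum_i w i *: p i.

Definition on_unit_sphere (R : realType) n r (p : 'I_n -> 'rV[R]_r) : Prop :=
  exists c : 'rV[R]_r, forall i, sqdist (p i) c = 1.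

Definition J_spherical (R : realType) n (g : sgraph n) r
    (p : 'I_n -> 'rV[R]_r) : Prop :=
  [/\ affinely_spans p,
      on_unit_sphere p &
      exists2 beta : R, 2 < beta &
        forall i j, i != j -> sqdist (p i) (p j) = if g i j then 2 else beta].

(* The ambient dimensions are not assumed equal; a bijective isometry forces
   r = r'. *)
Definition isometric (R : realType) n r r'
    (p : 'I_n -> 'rV[R]_r) (p' : 'I_n -> 'rV[R]_r') : Prop :=
  exists f : 'rV[R]_r -> 'rV[R]_r',
    [/\ bijective f,
        forall x y, sqdist (f x) (f y) = sqdist x y &
        forall i, f (p i) = p' i].

(* The default 0 is returned only if g has no J-spherical representation. *)
Definition dim_J (R : realType) n (g : sgraph n) : nat :=
  let dims := [set r | exists p : 'I_n -> 'rV[R]_r, J_spherical g p] in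
  xget 0%N [set d | dims d /\ forall r, dims r -> (d <= r)%N].

(* Main.v *)
Require Import Defs.
From HB Require Import structures.
From mathcomp Require Import all_boot all_order all_algebra.
From mathcomp Require Import classical_sets reals.
From mathcomp Require Import boolp ring lra.

Set Implicit Arguments.
Unset Strict Implicit.
Unset Printing Implicit Defensive.

Import Order.TTheory GRing.Theory Num.Theory.
Local Open Scope ring_scope.

(** Write [A] for the adjacency matrix of the complement of [g] and [l] for its
largest eigenvalue. Translate a J-spherical representation so that its sphere is
centred at the origin, and put the points in the rows of a matrix [P]. By
polarization the Gram matrix [P *m P^T] is [1 - d A], with [d = beta / 2 - 1 > 0].
Two facts force [d = l^-1]. A Gram matrix is positive semidefinite, so every
eigenvalue of [A] is at most [d^-1]. The points span affinely, so the centre has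
barycentric coordinates [w]; these satisfy [w P = 0], hence [w A = d^-1 w], so that
[d^-1] is an eigenvalue ([J_spherical_gram]). The distances are thus determined,
and so is the dimension, which is the rank of [1 - l^-1 A] ([rank_gram],
[rank_eigen]). Two full-rank factorizations of the same Gram matrix differ by an
orthogonal map, which gives uniqueness ([gram_isometry]).

For existence, [1 - l^-1 A] is symmetric positive semidefinite, hence is [P *m P^T]
with [P] of full column rank ([psdmx_gram]). The rows of [P] are unit vectors at
the required distances and span linearly. They span affinely because, [A] being
nonnegative, [l] has an eigenvector with coordinates summing to 1
([nonneg_top_eigenvector]): it expresses the origin as an affine combination of
the points ([J_spherical_exists]).

The spectral input, that a symmetric matrix [A] has an eigenvalue [a] with [a - A]
positive semidefinite, is obtained without diagonalization: [a] is the supremum of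
the Rayleigh quotients, and if [a - A] were invertible its factorization [P *m P^T]
would make its quadratic form coercive, leaving room below the supremum
([sym_top_eigenvalue]). *)

Section Dot.
Variables (R : realType).

(** * The standard inner product *)


Definition dot r (x y : 'rV[R]_r) : R := (x *m y^T) 0 0.

Lemma dotE r (x y : 'rV[R]_r) : dot x y = \sum_k x 0 k * y 0 k.
Proof. by rewrite /dot mxE; apply: eq_bigr => k _; rewrite mxE. Qed.

Lemma dotC r (x y : 'rV[R]_r) : dot x y = dot y x.
Proof. by rewrite !dotE; apply: eq_bigr => k _; rewrite mulrC. Qed.

Lemma dotDl r (x y z : 'rV[R]_r) : dot (x + y) z = dot x z + dot y z.
Proof. by rewrite /dot mulmxDl mxE. Qed.

Lemma dotZl r a (x z : 'rV[R]_r) : dot (a *: x) z = a * dot x z.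
Proof. by rewrite /dot -scalemxAl mxE. Qed.

Lemma dotNl r (x z : 'rV[R]_r) : dot (- x) z = - dot x z.
Proof. by rewrite -scaleN1r dotZl mulN1r. Qed.

Lemma dotDr r (x y z : 'rV[R]_r) : dot z (x + y) = dot z x + dot z y.
Proof. by rewrite dotC dotDl !(dotC z). Qed.

Lemma dotZr r a (x z : 'rV[R]_r) : dot z (a *: x) = a * dot z x.
Proof. by rewrite dotC dotZl dotC. Qed.

Lemma dotNr r (x z : 'rV[R]_r) : dot z (- x) = - dot z x.
Proof. by rewrite dotC dotNl dotC. Qed.

Lemma dot0l r (z : 'rV[R]_r) : dot 0 z = 0.
Proof. by rewrite /dot mul0mx mxE. Qed.

Lemma dot_mulmx r s (x : 'rV[R]_r) (A : 'M_(r, s)) y :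
  dot (x *m A) y = dot x (y *m A^T).
Proof. by rewrite /dot trmx_mul trmxK mulmxA. Qed.

Lemma dot_ge0 r (x : 'rV[R]_r) : 0 <= dot x x.
Proof. by rewrite dotE sumr_ge0 // => k _; rewrite -expr2 sqr_ge0. Qed.

Lemma dot_eq0 r (x : 'rV[R]_r) : dot x x = 0 -> x = 0.
Proof.
move=> /eqP; rewrite dotE psumr_eq0 => [/allP x0|k _]; last first.
  by rewrite -expr2 sqr_ge0.
apply/rowP => k; rewrite mxE; apply/eqP.
by have := x0 k (mem_index_enum k); rewrite mulf_eq0 orbb.
Qed.

Lemma dot_gt0 r (x : 'rV[R]_r) : x != 0 -> 0 < dot x x.
Proof.
by move=> x0; rewrite lt_def dot_ge0 andbT; apply: contra_neq x0 => /dot_eq0.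
Qed.

Lemma coord_le_dot r (x : 'rV[R]_r) k : x 0 k ^+ 2 <= dot x x.
Proof.
rewrite dotE (bigD1 k) //= -expr2 lerDl sumr_ge0 // => i _.
by rewrite -expr2 sqr_ge0.
Qed.

Lemma dot_row r n m (P : 'M[R]_(n, r)) (Q : 'M[R]_(m, r)) i j :
  dot (row i P) (row j Q) = (P *m Q^T) i j.
Proof. by rewrite dotE !mxE; apply: eq_bigr => k _; rewrite !mxE. Qed.

Lemma dot_delta n (x : 'rV[R]_n) i : dot x (delta_mx 0 i) = x 0 i.
Proof. by rewrite /dot trmx_delta -colE mxE. Qed.

Lemma sqdistE r (x y : 'rV[R]_r) : sqdist x y = dot (x - y) (x - y).
Proof. by rewrite dotE; apply: eq_bigr => k _; rewrite !mxE expr2. Qed.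

Lemma sqdist_polar r (x y : 'rV[R]_r) :
  sqdist x y = dot x x + dot y y - 2 * dot x y.
Proof. by rewrite sqdistE !(dotDl, dotDr, dotNl, dotNr) (dotC y x); ring. Qed.

(** * Positive semidefinite matrices are Gram matrices *)

Definition psdmx n (A : 'M[R]_n) := forall x, 0 <= dot (x *m A) x.

(** The form at [e_i + s e_j] is then at most [2 s M_ij], which has both signs as
[s] ranges over 1 and -1. *)
Lemma psdmx_diag0 n (M : 'M[R]_n) :
  M^T = M -> psdmx M -> (forall i, M i i <= 0) -> M = 0.
Proof.
move=> Msym Mpsd Mdiag; apply/matrixP => i j; rewrite mxE.
have step s : 0 <= 2 * s * M i j + s ^+ 2 * M j j + M i i.
  have := Mpsd (delta_mx 0 i + s *: delta_mx 0 j).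
  rewrite mulmxDl -scalemxAl -!rowE !(dotDl, dotDr, dotZl, dotZr) !dot_delta.
  have -> : row j M 0 i = M i j by rewrite mxE -[in LHS]Msym mxE.
  by rewrite !mxE; congr (0 <= _); ring.
have := step 1; have := step (-1); have := Mdiag i; have := Mdiag j.
lra.
Qed.

(** Cholesky factorization by induction on the rank: while some diagonal entry
[a = M_ii] is positive, subtracting [v^T v], where [v] is row [i] divided by
[sqrt a], keeps the matrix positive semidefinite and lowers its rank, because
[e_i] enters the kernel. *)
Lemma psdmx_gram n (M : 'M[R]_n) : M^T = M -> psdmx M ->
  exists k (P : 'M[R]_(n, k)), row_full P /\ P *m P^T = M.
Proof.
move=> Msym Mpsd.
(* A factor with at most rank M columns automatically has full column rank. *)
suff [k [P [kM PM]]] : exists k (P : 'M[R]_(n, k)),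
    (k <= \rank M)%N /\ P *m P^T = M.
  exists k, P; split=> //; rewrite /row_full eqn_leq rank_leq_col /=.
  by apply: leq_trans kM _; rewrite -PM mxrankM_maxl.
elim: {M}(\rank M).+1 {-2}M (ltnSn (\rank M)) Msym Mpsd => // m IHm M.
rewrite ltnS => rkM Msym Mpsd.
have [[i Mi_gt0]|noi] := pselect (exists i, 0 < M i i); last first.
  exists 0, 0; split=> //; rewrite mul0mx; apply/esym/psdmx_diag0 => // i.
  by rewrite leNgt; apply/negP => Mi; apply: noi; exists i.
pose a := M i i; have a0 : a != 0 by rewrite gt_eqF.
pose s := (Num.sqrt a)^-1; pose v := s *: row i M.
have ss : s ^+ 2 = a^-1 by rewrite exprVn sqr_sqrtr // ltW.
have vv : v^T *m v = a^-1 *: (col i M *m row i M).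
  rewrite /v [(s *: _)^T]linearZ /= -scalemxAl -scalemxAr scalerA -expr2 ss.
  by rewrite tr_row Msym.
pose M' := M - v^T *m v.
have M'sym : M'^T = M' by rewrite linearB /= trmx_mul trmxK Msym.
have dM' x : dot (x *m M') x = dot (x *m M) x - a^-1 * dot x (row i M) ^+ 2.
  rewrite /M' mulmxBr dotDl dotNl mulmxA (dot_mulmx _ v).
  rewrite [dot _ (_ *m v^T)]dotE big_ord1 -ss.
  have -> : (x *m v^T) 0 0 = s * dot x (row i M) by rewrite -/(dot x v) dotZr.
  by congr (_ - _); ring.
have M'psd : psdmx M'.
  (* The form of M' at x is the form of M at the point of the line x + R e_i
     that minimizes it. *)
  move=> x; rewrite dM'; pose c := dot x (row i M) / a.
  have := Mpsd (x - c *: delta_mx 0 i).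
  rewrite mulmxBl -scalemxAl -rowE !(dotDl, dotDr, dotZl, dotZr, dotNl, dotNr).
  rewrite !dot_delta dot_mulmx Msym.
  have -> : (x *m M) 0 i = dot x (row i M).
    by rewrite -[LHS]dot_delta dot_mulmx Msym -rowE.
  rewrite (dotC _ x) [row i M 0 i]mxE -/a.
  by rewrite {}/c; congr (0 <= _); field.
have ltM' : (\rank M' < \rank M)%N.
  apply: rank_ltmx; rewrite /ltmx; apply/andP; split.
    apply: addmx_sub (submx_refl _) _; rewrite eqmx_opp vv; apply: scalemx_sub.
    by rewrite rowE mulmxA submxMl.
  have M'i : M' *m (delta_mx 0 i : 'rV_n)^T = 0.
    rewrite /M' mulmxBl vv -scalemxAl -mulmxA.
    have -> : row i M *m (delta_mx 0 i : 'rV_n)^T = a%:M.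
      by apply/rowP => j; rewrite ord1 -/(dot _ _) dot_delta !mxE.
    by rewrite mul_mx_scalar scalerA mulVf // scale1r trmx_delta -colE subrr.
  apply: contra a0 => /submxP[B MB].
  have : M *m (delta_mx 0 i : 'rV_n)^T = 0 by rewrite MB -mulmxA M'i mulmx0.
  by rewrite trmx_delta -colE => /colP/(_ i); rewrite !mxE /a => ->.
have [k [P [kM' PM']]] := IHm M' (leq_trans ltM' rkM) M'sym M'psd.
exists (k + 1)%N, (row_mx P v^T); split.
  by rewrite addn1; apply: leq_ltn_trans ltM'.
by rewrite tr_row_mx mul_row_col PM' trmxK /M' subrK.
Qed.

Lemma psdmx_ker n (M : 'M[R]_n) (x : 'rV_n) :
  M^T = M -> psdmx M -> dot (x *m M) x <= 0 -> x *m M = 0.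
Proof.
move=> Msym Mpsd; have [k [P [_ <-]]] := psdmx_gram Msym Mpsd.
rewrite mulmxA dot_mulmx trmxK => xP_le0.
suff -> : x *m P = 0 by rewrite mul0mx.
by apply: dot_eq0; apply/eqP; rewrite eq_le xP_le0 dot_ge0.
Qed.

(** * The largest eigenvalue of a symmetric matrix *)

Lemma qform_bounded n (A : 'M[R]_n) :
  exists2 t, 0 < t & forall x, dot (x *m A) x <= t * dot x x.
Proof.
exists (1 + \sum_j \sum_i `|A i j|).
  by rewrite ltr_pwDl // sumr_ge0 // => j _; rewrite sumr_ge0.
move=> x; rewrite mulrDl mul1r -[leLHS]add0r lerD ?dot_ge0 //.
rewrite [leLHS]dotE mulr_suml ler_sum // => j _.
rewrite mxE !mulr_suml ler_sum // => i _.
rewrite mulrAC [leRHS]mulrC; apply: le_trans (ler_norm _) _.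
rewrite normrM ler_wpM2r // ler_norml.
have := coord_le_dot x i; have := coord_le_dot x j.
have := sqr_ge0 (x 0 i + x 0 j); have := sqr_ge0 (x 0 i - x 0 j).
by rewrite !expr2 => *; apply/andP; split; nra.
Qed.

Lemma dot_shift n (A : 'M[R]_n) a x :
  dot (x *m (a%:M - A)) x = a * dot x x - dot (x *m A) x.
Proof. by rewrite mulmxBr mul_mx_scalar dotDl dotNl dotZl. Qed.

Lemma sym_shift n (A : 'M[R]_n) a : A^T = A -> (a%:M - A)^T = a%:M - A.
Proof. by move=> Asym; rewrite linearB /= tr_scalar_mx Asym. Qed.

(** The value [a] is the supremum of the Rayleigh quotients of [A]. If it were not
an eigenvalue, [a - A] would factor as [P *m P^T] with [P] invertible, and the
norm bound on the inverse of [P] would give a constant [t > 0] such that all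
quotients are at most [a - t^-1]. The index [i0] excludes the empty matrix. *)
Lemma sym_top_eigenvalue n (A : 'M[R]_n) (i0 : 'I_n) : A^T = A ->
  exists2 a, eigenvalue A a & psdmx (a%:M - A).
Proof.
move=> Asym.
pose T := [set a | exists2 x : 'rV_n,
  x != 0 & a * dot x x <= dot (x *m A) x]%classic.
have T0 : (T !=set0)%classic.
  exists (A i0 i0), (delta_mx 0 i0).
    apply/negP => /eqP/rowP/(_ i0); rewrite !mxE !eqxx => /eqP.
    by rewrite oner_eq0.
  by rewrite !dot_delta -rowE !mxE !eqxx mulr1.
have Tub : has_ubound T.
  have [t _ tA] := qform_bounded A; exists t => a [x /dot_gt0 x0 ax].
  by rewrite -(ler_pM2r x0) (le_trans ax).
pose a := sup T.
have apsd : psdmx (a%:M - A).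
  move=> x; rewrite dot_shift subr_ge0.
  have [->|x0] := eqVneq x 0; first by rewrite mul0mx !dot0l mulr0.
  rewrite -ler_pdivrMr ?dot_gt0 //; apply: ub_le_sup => //.
  by exists x => //; rewrite divfK // gt_eqF ?dot_gt0.
exists a => //; apply: contrapT => noeig.
have [k [P [_ PM]]] := psdmx_gram (sym_shift a Asym) apsd.
have Pfree : row_free P.
  rewrite -kermx_eq0; apply/negPn/negP => /rowV0Pn[x /sub_kermxP xP x0].
  apply: noeig; apply/eigenvalueP; exists x => //.
  apply/esym/eqP; rewrite -subr_eq0 -mul_mx_scalar -mulmxBr -PM mulmxA xP.
  by rewrite mul0mx.
have [t t0 tP] := qform_bounded (pinvmx P *m (pinvmx P)^T).
suff : a <= a - t^-1 by rewrite lerBrDl gerDr leNgt invr_gt0 t0.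
apply: ge_sup => // b [x /dot_gt0 x0 bx].
have xt : t^-1 * dot x x <= dot (x *m (a%:M - A)) x.
  rewrite ler_pdivrMl // -PM mulmxA dot_mulmx trmxK; apply: le_trans (tP _).
  have xPV : x *m P *m pinvmx P = x by rewrite -mulmxA mulmxVp // mulmx1.
  by rewrite mulmxA xPV dot_mulmx trmxK xPV.
rewrite -(ler_pM2r x0) mulrBl lerBrDr addrC -lerBrDr.
by move: bx xt; rewrite dot_shift; lra.
Qed.

Lemma largest_eigenvalue_psd n (A : 'M[R]_n) a :
  eigenvalue A a -> psdmx (a%:M - A) -> largest_eigenvalue A = a.
Proof.
move=> Aa apsd; have ub b : eigenvalue A b -> b <= a.
  case/eigenvalueP => x xA /dot_gt0 x0; have := apsd x.
  by rewrite dot_shift xA dotZl subr_ge0 ler_pM2r.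
apply: xget_unique; first by split=> // b /ub.
by move=> b [Ab bub]; apply/eqP; rewrite eq_le ub //= bub.
Qed.

(** The part of the Perron-Frobenius theorem that survives without irreducibility:
replacing the coordinates of an eigenvector by their absolute values does not
decrease the Rayleigh quotient, so the result still maximizes it and is again an
eigenvector. Being nonnegative and nonzero, it can be normalized. *)
Lemma nonneg_top_eigenvector n (A : 'M[R]_n) a :
  A^T = A -> (forall i j, 0 <= A i j) -> eigenvalue A a -> psdmx (a%:M - A) ->
  exists x : 'rV_n, x *m A = a *: x /\ \sum_i x 0 i = 1.
Proof.
move=> Asym A0 /eigenvalueP[x xA x0] apsd.
pose y := map_mx Num.norm x.
have yE i : y 0 i = `|x 0 i| by rewrite mxE.
have yA : y *m A = a *: y.
  apply/esym/eqP; rewrite -subr_eq0 -mul_mx_scalar -mulmxBr; apply/eqP.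
  apply: psdmx_ker => //; first exact: sym_shift.
  rewrite dot_shift subr_le0.
  have -> : dot y y = dot x x.
    rewrite !dotE; apply: eq_bigr => i _.
    by rewrite yE -!expr2 real_normK ?num_real.
  rewrite -dotZl -xA !dotE ler_sum // => i _.
  rewrite yE (le_trans (ler_norm _)) // normrM ler_wpM2r // !mxE.
  rewrite (le_trans (ler_norm_sum _ _ _)) // ler_sum // => j _.
  by rewrite yE normrM (ger0_norm (A0 _ _)).
have s0 : \sum_i y 0 i != 0.
  apply: contra x0; rewrite psumr_eq0 => [/allP y0|i _]; last by rewrite yE.
  apply/eqP/rowP => i; apply/eqP; rewrite [eqbRHS]mxE -normr_eq0 -yE.
  exact: y0 (mem_index_enum i).
exists ((\sum_i y 0 i)^-1 *: y); split.
  by rewrite -scalemxAl yA !scalerA mulrC.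
by under eq_bigr do rewrite mxE; rewrite -mulr_sumr mulVf.
Qed.

(** * Congruence of configurations with the same Gram matrix *)

(** The matrix [U := pinvmx P *m Q] carries [P] to [Q]; the same construction in the
other direction inverts it, and equality of the Gram matrices makes it
orthogonal. *)
Lemma gram_isometry n r s (P : 'M[R]_(n, r)) (Q : 'M[R]_(n, s)) c d :
  row_full P -> row_full Q -> P *m P^T = Q *m Q^T ->
  isometric (fun i => row i P + c) (fun i => row i Q + d).
Proof.
suff transfer u v (A : 'M[R]_(n, u)) (B : 'M[R]_(n, v)) :
    row_full A -> row_full B ->
    A *m A^T = B *m B^T -> A *m (pinvmx A *m B) = B.
  move=> Pf Qf PQ; pose U := pinvmx P *m Q; pose V := pinvmx Q *m P.
  have PU : P *m U = Q by exact: transfer.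
  have QV : Q *m V = P by apply: transfer.
  have UV : U *m V = 1%:M by rewrite -mulmxA QV mulVpmx.
  have VU : V *m U = 1%:M by rewrite -mulmxA PU mulVpmx.
  have UU : U *m U^T = 1%:M.
    rewrite trmx_mul !mulmxA -(mulmxA _ Q) -PQ !mulmxA mulVpmx // mul1mx.
    by rewrite -trmx_mul mulVpmx // trmx1.
  exists (fun x => (x - c) *m U + d); split.
  - exists (fun y => (y - d) *m V + c) => x.
      by rewrite addrK -mulmxA UV mulmx1 subrK.
    by rewrite addrK -mulmxA VU mulmx1 subrK.
  - move=> x y; rewrite !sqdistE opprD addrACA subrr addr0 -mulmxBl.
    by rewrite opprD addrACA subrr addr0 dot_mulmx -mulmxA UU mulmx1.
  - by move=> i; rewrite addrK -row_mul PU.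
move=> Af Bf AB; apply/eqP; rewrite mulmxA -subr_eq0.
rewrite -[X in _ - X]mul1mx -mulmxBl.
(* B^T cancels on the right, and turns the claim into one about the common Gram
   matrix, where it holds because pinvmx A is a left inverse of A. *)
have Bt : row_free B^T by rewrite /row_free mxrank_tr.
rewrite -(mulmx_free_eq0 _ Bt) -mulmxA -AB mulmxA mulmxBl -mulmxA mulVpmx //.
by rewrite mulmx1 mul1mx subrr mul0mx.
Qed.

Lemma rank_gram n r (P : 'M[R]_(n, r)) : row_full P -> \rank (P *m P^T) = r.
Proof.
move=> Pf; rewrite mxrankMfree; first exact/eqP.
by rewrite /row_free mxrank_tr.
Qed.

Lemma rank_eigen n (A : 'M[R]_n) a :
  a != 0 -> \rank (1%:M - a^-1 *: A) = (n - eigen_mult A a)%N.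
Proof.
move=> a0; rewrite /eigen_mult /eigenspace mxrank_ker.
have -> : 1%:M - a^-1 *: A = - a^-1 *: (A - a%:M).
  by rewrite scalerBr !scaleNr scale_scalar_mx mulVf // opprK addrC.
rewrite mxrank_scale_nz ?oppr_eq0 ?invr_eq0 //.
by rewrite subKn // rank_leq_row.
Qed.

(** * J-spherical representations *)

Section Representations.
Variables (n : nat) (g : sgraph n).
Let A : 'M[R]_n := adjmx R (compl_graph g).

Lemma compl_adjmx_sym : A^T = A.
Proof. by apply/matrixP => i j; rewrite !mxE /= compl_adj_sym. Qed.

Lemma compl_adjmx_diag i : A i i = 0.
Proof. by rewrite mxE /= compl_adj_irrefl. Qed.

(** The factor [P] holds the points relative to the centre [c] of their sphere.
That the scale in the Gram matrix is the inverse of the largest eigenvalue comes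
from the barycentric coordinates of [c], which form an eigenvector. *)
Lemma J_spherical_gram r (p : 'I_n -> 'rV[R]_r) : J_spherical g p ->
  exists (P : 'M[R]_(n, r)) c, [/\ row_full P, forall i, p i = row i P + c
    & P *m P^T = 1%:M - (largest_eigenvalue A)^-1 *: A
     /\ 0 < largest_eigenvalue A].
Proof.
move=> [spanp [c pc] [beta beta2 pbeta]].
pose P : 'M[R]_(n, r) := \matrix_i (p i - c).
(* Off the edges, the inner product of two centred points is 1 - beta / 2. *)
pose a := (beta / 2 - 1)^-1.
have a0 : 0 < a by rewrite invr_gt0; lra.
have rPE i : row i P = p i - c by rewrite rowK.
have wP (w : 'I_n -> R) :
    \sum_i w i = 1 -> (\row_i w i) *m P = \sum_i w i *: p i - c.
  move=> w1; rewrite mulmx_sum_row.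
  under eq_bigr => i _ do rewrite mxE rPE scalerBr.
  by rewrite sumrB -scaler_suml w1 scale1r.
have PP : P *m P^T = 1%:M - a^-1 *: A.
  apply/matrixP => i j; rewrite -dot_row !rPE.
  have pp k : dot (p k - c) (p k - c) = 1 by rewrite -sqdistE.
  have := sqdist_polar (p i - c) (p j - c).
  rewrite !pp sqdistE opprB addrA subrK -sqdistE !mxE /= /compl_adj.
  have [->|ij] := eqVneq i j; first by rewrite !pp mulr0 subr0.
  by rewrite invrK pbeta //=; case: (g i j); rewrite /= ?mulr0 ?mulr1; lra.
have Pf : row_full P.
  rewrite -sub1mx; apply/row_subP => i.
  have [w w1 wE] := spanp (row i 1%:M + c).
  by apply/submxP; exists (\row_i w i); rewrite wP // -wE addrK.
have [w w1 wE] := spanp c.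
have wP0 : (\row_i w i) *m P = 0 by rewrite wP // -wE subrr.
have eqa : largest_eigenvalue A = a.
  apply: largest_eigenvalue_psd.
    apply/eigenvalueP; exists (\row_i w i); last first.
      apply/eqP => /rowP w0; move: w1; rewrite big1 => [/esym/eqP|i _].
        by rewrite oner_eq0.
      by have := w0 i; rewrite !mxE.
    have : a *: ((\row_i w i) *m (P *m P^T)) = 0.
      by rewrite mulmxA wP0 mul0mx scaler0.
    rewrite PP mulmxBr -scalemxAr mulmx1 scalerBr scalerA mulfV ?gt_eqF //.
    by rewrite scale1r => /eqP; rewrite subr_eq0 => /eqP.
  move=> x; have -> : a%:M - A = a *: (P *m P^T).
    rewrite PP scalerBr scalerA mulfV ?gt_eqF // scale1r.
    by rewrite scale_scalar_mx mulr1.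
  rewrite -scalemxAr dotZl mulmxA dot_mulmx trmxK mulr_ge0 ?dot_ge0 //.
  exact: ltW.
by exists P, c; split=> [//|i|]; [rewrite rPE subrK|rewrite eqa].
Qed.

(** A nonadjacent pair is needed for the largest eigenvalue to be positive: the
form of the complement at [e_i + e_j] is then positive. *)
Lemma J_spherical_exists : ~ complete_graph g ->
  exists r (p : 'I_n -> 'rV[R]_r), J_spherical g p.
Proof.
move=> gnc.
have [i [j [ij gij]]] : exists i j, i != j /\ ~~ g i j.
  apply: contrapT => no; apply: gnc => i j ij; apply/negPn/negP => gij.
  by apply: no; exists i, j.
have [a Aa apsd] := sym_top_eigenvalue i compl_adjmx_sym.
have a0 : 0 < a.
  have := apsd (delta_mx 0 i + delta_mx 0 j).
  rewrite dot_shift mulmxDl -!rowE !(dotDl, dotDr) !dot_delta !mxE /=.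
  rewrite /compl_adj !eqxx /= ij (eq_sym j i) (negPf ij).
  rewrite (adj_sym g j) (negPf gij) /=.
  by lra.
have Gsym : (1%:M - a^-1 *: A)^T = 1%:M - a^-1 *: A.
  by rewrite linearB linearZ /= trmx1 compl_adjmx_sym.
have Gpsd : psdmx (1%:M - a^-1 *: A).
  move=> x; have -> : 1%:M - a^-1 *: A = a^-1 *: (a%:M - A).
    by rewrite scalerBr scale_scalar_mx mulVf // gt_eqF.
  by rewrite -scalemxAr dotZl mulr_ge0 // invr_ge0 ltW.
have [k [P [Pf PP]]] := psdmx_gram Gsym Gpsd.
have dotP s t : dot (row s P) (row t P) = (s == t)%:R - a^-1 * A s t.
  by rewrite dot_row PP !mxE.
have A0 s t : 0 <= A s t by rewrite mxE.
have [w [wA w1]] := nonneg_top_eigenvector compl_adjmx_sym A0 Aa apsd.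
have wP : w *m P = 0.
  apply: dot_eq0; rewrite dot_mulmx -mulmxA PP mulmxBr mulmx1 -scalemxAr wA.
  by rewrite scalerA mulVf ?gt_eqF // scale1r subrr dotC dot0l.
exists k, (fun i => row i P); split.
- move=> x; have /submxP[v xv] : (x <= P)%MS by apply: submx_full.
  (* Adding a multiple of w does not move the point, as w P = 0, and is used to
     make the weights sum to 1. *)
  exists (fun i => (v + (1 - \sum_i v 0 i) *: w) 0 i).
    under eq_bigr => s _ do rewrite !mxE.
    by rewrite big_split /= -mulr_sumr w1 mulr1 addrC subrK.
  by rewrite -mulmx_sum_row mulmxDl -scalemxAl wP scaler0 addr0.
- exists 0 => s.
  by rewrite sqdistE subr0 dotP eqxx compl_adjmx_diag mulr0 subr0.
(* This beta is 2 (1 + a^-1), from inner product - a^-1 between unit vectors. *)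
exists (2 + 2 * a^-1); first by rewrite ltrDl mulr_gt0 ?invr_gt0.
move=> s t st; rewrite sqdist_polar !dotP !eqxx !compl_adjmx_diag (negPf st).
by rewrite !mxE /= /compl_adj st /=; case: (g s t) => /=; ring.
Qed.
End Representations.
End Dot.

Theorem theorem6p1 (R : realType) (n : nat) (g : sgraph n)
    (g_not_complete : ~ complete_graph g) (g_not_null : ~ null_graph g) :
  let Abar : 'M[R]_n := adjmx R (compl_graph g) in
  let lambda1 : R := largest_eigenvalue Abar in
  let delta : R := 1 / lambda1 in
  let E : 'M[R]_n := const_mx 1 in
  let I : 'M[R]_n := 1%:M in
  (exists (r : nat) (p : 'I_n -> 'rV[R]_r),
     [/\ J_spherical g p,
         edm p = 2 *: (E - I) + (2 * delta) *: Abar &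
         forall (r' : nat) (p' : 'I_n -> 'rV[R]_r'),
           J_spherical g p' -> isometric p p'])
  /\ dim_J R g = (n - eigen_mult Abar lambda1)%N.
Proof.
move=> Abar lambda1 delta E I.
have [r [p pJ]] := J_spherical_exists R g_not_complete.
have [P [c [Pf pE [PP l0]]]] := J_spherical_gram pJ.
have dimE r' (p' : 'I_n -> 'rV[R]_r') :
    J_spherical g p' -> r' = (n - eigen_mult Abar lambda1)%N.
  move=> p'J; have [Q [d [Qf _ [QQ _]]]] := J_spherical_gram p'J.
  by rewrite -(rank_gram Qf) QQ rank_eigen // gt_eqF.
split; last first.
  apply: xget_unique.
    rewrite -(dimE _ _ pJ); split=> [|s [q /dimE ->]]; first by exists p.
    by rewrite (dimE _ _ pJ).
  by move=> d [[q /dimE]].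
exists r, p; split=> // [|r' p' p'J].
  apply/matrixP => i j.
  have PPE s t : dot (row s P) (row t P) = (s == t)%:R - lambda1^-1 * Abar s t.
    by rewrite dot_row PP !mxE.
  have -> : edm p i j = sqdist (row i P) (row j P).
    by rewrite mxE !sqdistE !pE opprD addrACA subrr addr0.
  rewrite sqdist_polar !PPE !eqxx !compl_adjmx_diag !mxE /delta /=; ring.
have [Q [d [Qf qE [QQ _]]]] := J_spherical_gram p'J.
have [f [fbij fiso fE]] := gram_isometry c d Pf Qf (etrans PP (esym QQ)).
by exists f; split=> // i; rewrite pE qE.
Qed.
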